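(* Let $\mathcal{G}$ be a finite group, let $\varepsilon \in [0,\infty)$, $p \in (0,\infty]$, and $C_0, N \in \mathbb{N}$. Let $\Omega \subset \mathbb{R}^{[C_0] \times \mathcal{G}}$ be $\mathcal{G}$-invariant and measurable, and let $\varrho : \mathbb{R} \to \mathbb{R}$ be measurable. Let $F : \mathbb{R}^{[C_0] \times \mathcal{G}} \to \mathbb{R}^{[N] \times \mathcal{G}}$ be measurable and translation equivariant, and let $\Phi$ be a fully-connected neural network (FNN) of architecture $\mathcal{A}(\Phi) = (C_0 \cdot |\mathcal{G}|, N_1, \dots, N_{L-1}, N)$ satisfying $\|(F)_1 - R_\varrho(\Phi)\|_{L^p(\Omega, \mathbb{R}^N)} \leq \varepsilon$. Then there is a convolutional neural network (CNN) $\Psi$ with channel counts $(C_0, N_1, \dots, N_{L-1}, N)$, with filter counts $(N_1 \cdot C_0, 1, \dots, 1)$ (where $N_L := N$), and such that $$\|F - R_\varrho(\Psi)\|_{L^p(\Omega, \mathbb{R}^{[N] \times \mathcal{G}})} \leq |\mathcal{G}|^{1/p} \cdot \varepsilon \qquad \text{and} \qquad W_{\mathrm{conv}}(\Psi) \leq 2 \cdot W(\Phi).$$ Here the convention $|\mathcal{G}|^{1/\infty} = 1$ is used.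
   Context: Notation: $[M] := \{1,\dots,M\}$; $\mathbb{R}^I$ is the space of real families indexed by the finite set $I$; $1 \in \mathcal{G}$ is the identity. For $x \in \mathbb{R}^{I \times \mathcal{G}}$ write $x_i := (x_{i,g})_{g \in \mathcal{G}} \in \mathbb{R}^{\mathcal{G}}$. Equivariance: $S_g : \mathbb{R}^{\mathcal{G}} \to \mathbb{R}^{\mathcal{G}}$, $(x_h)_h \mapsto (x_{g^{-1}h})_h$, and $S_g^{\mathrm{vec},I} : \mathbb{R}^{I\times\mathcal{G}} \to \mathbb{R}^{I \times \mathcal{G}}$, $(x_i)_{i\in I} \mapsto (S_g x_i)_{i \in I}$. A map $F : \mathbb{R}^{I\times\mathcal{G}} \to \mathbb{R}^{J\times\mathcal{G}}$ is translation equivariant if $F \circ S_g^{\mathrm{vec},I} = S_g^{\mathrm{vec},J} \circ F$ for all $g \in \mathcal{G}$. A set $\Omega \subset \mathbb{R}^{I \times \mathcal{G}}$ is $\mathcal{G}$-invariant if $S_g^{\mathrm{vec},I}(\Omega) \subset \Omega$ for all $g\in\mathcal{G}$. For $F$ with values in $\mathbb{R}^{J\times\mathcal{G}}$, $(F)_1(x) := (F(x)_{j,1})_{j\in J} \in \mathbb{R}^J$. Norms: $\|f\|_{L^p(\Omega,\mathbb{R}^J)} := \big\| x \mapsto \|f(x)\|_{\ell^p}\big\|_{L^p(\Omega)}$ for measurable $f:\Omega\to\mathbb{R}^J$, $J$ finite. Counting: for a vector $b$, $\|b\|_{\ell^0}$ is its number of nonzero entries; for an affine-linear map $V = b + A(\cdot)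 : \mathbb{R}^I\to\mathbb{R}^J$, $\|V\|_{\ell^0} := \|b\|_{\ell^0} + \|A\|_{\ell^0}$, where $\|A\|_{\ell^0}$ is the number of nonzero entries of the matrix of $A$ in the standard bases. FNNs: an FNN is a tuple $\Phi = (V_1,\dots,V_L)$, $L\in\mathbb{N}$, of affine-linear maps $V_1 : \mathbb{R}^{[C_0]\times\mathcal{G}} \to \mathbb{R}^{N_1}$ and $V_\ell : \mathbb{R}^{N_{\ell-1}}\to\mathbb{R}^{N_\ell}$ ($1<\ell\leq L$, all $N_\ell\in\mathbb{N}$). Its architecture is $\mathcal{A}(\Phi) := (C_0\cdot|\mathcal{G}|, N_1,\dots,N_L)$, its number of weights is $W(\Phi) := \sum_{\ell=1}^L \|V_\ell\|_{\ell^0}$, and its $\varrho$-realisation $R_\varrho(\Phi) : \mathbb{R}^{[C_0]\times\mathcal{G}}\to\mathbb{R}^{N_L}$ is $V_L\circ\varrho\circ V_{L-1}\circ\cdots\circ\varrho\circ V_1$, with $\varrho$ applied componentwise. CNNs: for $a,b:\mathcal{G}\to\mathbb{R}$, $(a\ast b)(g) := \sum_{h\in\mathcal{G}} a(h)\,b(h^{-1}g)$. A map $B : \mathbb{R}^{[C_1]\times\mathcal{G}} \to \mathbb{R}^{[k]\times[C_1]\times\mathcal{G}}$ is filtering with $k$ filters, written $B \in \mathrm{filter}(\mathcal{G},k,C_1)$, if there are $a_1,\dots,a_k\in\mathbb{R}^{\mathcal{G}}$ with $B((x_i)_{i\in[C_1]}) = (x_j\ast a_r)_{(r,j)\in[k]\times[C_1]}$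 for all inputs; then $\|B\|_{\ell^0_{\mathrm{filter}}} := \sum_{r=1}^k\|a_r\|_{\ell^0}$. For $A : \mathbb{R}^J\to\mathbb{R}^I$ the lifting $A^{\uparrow} : \mathbb{R}^{J\times\mathcal{G}}\to\mathbb{R}^{I\times\mathcal{G}}$ applies $A$ separately for each $g$: $(A^{\uparrow}x)_{i,g} := [A((x_{j,g})_{j\in J})]_i$. A map $T : \mathbb{R}^{[C_1]\times\mathcal{G}}\to\mathbb{R}^{[C_2]\times\mathcal{G}}$ belongs to $\mathrm{Conv}(\mathcal{G},k,C_1,C_2)$ if $T = A^{\uparrow}\circ B$ for some $B\in\mathrm{filter}(\mathcal{G},k,C_1)$ and some affine-linear $A : \mathbb{R}^{[k]\times[C_1]}\to\mathbb{R}^{[C_2]}$; then $\|T\|_{\ell^0_{\mathrm{conv}}}$ is the minimum of $\|A\|_{\ell^0} + \|B\|_{\ell^0_{\mathrm{filter}}}$ over all such representations (with this $k$). A CNN with $L$ layers, channel counts $(C_0,\dots,C_L)$ and filter counts $(k_1,\dots,k_L)$ (all in $\mathbb{N}$) is a tuple $\Psi = (T_1,\dots,T_L)$ with $T_\ell\in\mathrm{Conv}(\mathcal{G},k_\ell,C_{\ell-1},C_\ell)$. Its $\varrho$-realisation $R_\varrho(\Psi) : \mathbb{R}^{[C_0]\times\mathcal{G}}\to\mathbb{R}^{[C_L]\times\mathcal{G}}$ is $T_L\circ\varrho\circ T_{L-1}\circ\cdots\circ\varrho\circ T_1$ ($\varrho$ componentwise), and its number of weights is $W_{\mathrm{conv}}(\Psi)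 := \sum_{\ell=1}^L\|T_\ell\|_{\ell^0_{\mathrm{conv}}}$. *)

(* Defs.v *)
From HB Require Import structures.
From mathcomp Require Import all_boot all_order all_algebra all_fingroup.
From mathcomp Require Import all_classical all_reals all_analysis.

Set Implicit Arguments.
Unset Strict Implicit.
Unset Printing Implicit Defensive.

Import Order.TTheory GRing.Theory Num.Theory.
Import numFieldNormedType.Exports.

Local Open Scope classical_set_scope.
Local Open Scope ring_scope.

Definition cylinder {d} {T : measurableType d} {I : finType} :
    set (set {ffun I -> T}) :=
  [set C | exists i : I, exists2 B : set T,
     measurable B & C = (fun x : {ffun I -> T} => x i) @^-1` B].

Definition measure_ffun_display : measure_display -> measure_display.
Proof. exact. Qed.

HB.instance Definition _ (T : pointedType) (I : finType) :=
  isPointed.Build {ffun I -> T} [ffun=> point].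

Section measurable_ffun.
Context {d} {T : measurableType d} {I : finType}.

Let ffun_set0 : <<s @cylinder d T I >> set0.
Proof. exact: sigma_algebra0. Qed.

Let ffun_setC (A : set {ffun I -> T}) :
  <<s cylinder >> A -> <<s cylinder >> (~` A).
Proof. by move=> sA; rewrite -setTD; exact: sigma_algebraCD. Qed.

Let ffun_bigcup (F : (set {ffun I -> T})^nat) :
  (forall i, <<s cylinder >> (F i)) -> <<s cylinder >> (\bigcup_i F i).
Proof. exact: sigma_algebra_bigcup. Qed.

HB.instance Definition _ := @isMeasurable.Build (measure_ffun_display d)
  {ffun I -> T} <<s cylinder >> ffun_set0 ffun_setC ffun_bigcup.

End measurable_ffun.

Lemma measurable_ffun_coord d (T : measurableType d) (I : finType) (i : I) :
  measurable_fun [set: {ffun I -> T}] (fun x : {ffun I -> T} => x i).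
Proof.
move=> _ B mB; rewrite setTI; apply: sub_sigma_algebra.
by exists i, B.
Qed.

Lemma measurable_ffunP d d' (S : measurableType d) (T : measurableType d')
    (I : finType) (f : S -> {ffun I -> T}) :
  (forall i, measurable_fun [set: S] (fun s => f s i)) ->
  measurable_fun [set: S] f.
Proof.
move=> mf; apply: (@measurability _ _ _ _ _ _ (@cylinder _ T I)) => //.
move=> _ [_ [i [B mB ->]] <-]; exact: mf.
Qed.

Section lebesgue_cons.
Context {R : realType} (n : nat).
Local Open Scope ereal_scope.
Local Notation mR := (measurableTypeR R).
Variable m : {sigma_finite_measure set (n.-tuple mR) -> \bar R}.

Definition cons_pair (u : mR * n.-tuple mR) : n.+1.-tuple mR :=
  [tuple of u.1 :: u.2].

Definition uncons_pair (t : n.+1.-tuple mR) : mR * n.-tuple mR :=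
  (thead t, [tuple of behead t]).

Lemma uncons_pairK : cancel cons_pair uncons_pair.
Proof.
by move=> [x t]; congr pair => //=; apply/val_inj.
Qed.

Lemma measurable_cons_pair : measurable_fun [set: mR * n.-tuple mR] cons_pair.
Proof.
by apply: measurable_cons; [exact: measurable_fst|exact: measurable_snd].
Qed.

Lemma measurable_uncons_pair : measurable_fun [set: n.+1.-tuple mR] uncons_pair.
Proof.
apply/measurable_fun_pairP; split; first exact: measurable_tnth.
apply/measurable_fun_tnthP => i.
rewrite (_ : _ \o _ = fun t => tnth t (lift ord0 i)).
  exact: measurable_tnth.
apply/funext => t /=; rewrite tnth_behead; congr tnth; apply/val_inj.
by rewrite /= inordK// ltnS ltn_ord.
Qed.

Definition lebesgue_cons := pushforward (@lebesgue_measure R \x m) cons_pair.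

Let mcons (A : set (n.+1.-tuple mR)) :
  measurable A -> measurable (cons_pair @^-1` A).
Proof. by move=> mA; rewrite -[_ @^-1` _]setTI; exact: measurable_cons_pair. Qed.

Let lebesgue_cons0 : lebesgue_cons set0 = 0.
Proof. by rewrite /lebesgue_cons /pushforward preimage_set0 measure0. Qed.

Let lebesgue_cons_ge0 A : 0 <= lebesgue_cons A.
Proof. by apply: integral_ge0 => *; exact: measure_ge0. Qed.

Let lebesgue_cons_sigma_additive : semi_sigma_additive lebesgue_cons.
Proof.
move=> F mF tF mUF; rewrite /lebesgue_cons /pushforward preimage_bigcup.
apply: measure_semi_sigma_additive.
- by move=> i; exact: mcons.
- apply/trivIsetP => /= i j _ _ ij; rewrite -preimage_setI.
  by move/trivIsetP : tF => /(_ _ _ _ _ ij) ->//; rewrite preimage_set0.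
- by rewrite -preimage_bigcup; exact: mcons.
Qed.

HB.instance Definition _ := isMeasure.Build _ _ _ lebesgue_cons
  lebesgue_cons0 lebesgue_cons_ge0 lebesgue_cons_sigma_additive.

Let lebesgue_cons_sigma_finite : sigma_finite setT lebesgue_cons.
Proof.
have /sigma_finiteP[F [FT ndF Foo]] := sigma_finiteT (@lebesgue_measure R).
have /sigma_finiteP[G [GT ndG Goo]] := sigma_finiteT m.
exists (fun i => uncons_pair @^-1` (F i `*` G i)).
  apply/seteqP; split=> // t _.
  have [i _ Fi] : (\bigcup_i F i) (uncons_pair t).1 by rewrite -FT.
  have [j _ Gj] : (\bigcup_i G i) (uncons_pair t).2 by rewrite -GT.
  exists (maxn i j) => //; split.
  - by move: Fi; exact/subsetPset/ndF/leq_maxl.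
  - by move: Gj; exact/subsetPset/ndG/leq_maxr.
move=> i; have [mFi Fioo] := Foo i; have [mGi Gioo] := Goo i; split.
  rewrite -[_ @^-1` _]setTI; apply: measurable_uncons_pair => //.
  exact: measurableX.
rewrite /lebesgue_cons /pushforward -comp_preimage.
rewrite (_ : _ \o _ = id); last by apply/funext => u /=; rewrite uncons_pairK.
by rewrite preimage_id product_measure1E// lte_mul_pinfty// ge0_fin_numE.
Qed.

HB.instance Definition _ := Measure_isSigmaFinite.Build _ _ _ lebesgue_cons
  lebesgue_cons_sigma_finite.

End lebesgue_cons.

Fixpoint lebesgue_tuple (R : realType) (n : nat) :
    {sigma_finite_measure set (n.-tuple (measurableTypeR R)) -> \bar R} :=
  if n is n'.+1 then lebesgue_cons (lebesgue_tuple R n') else \d_[tuple].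

Lemma lebesgue_tuple_box (R : realType) n (A : 'I_n -> set (measurableTypeR R)) :
  (forall i, measurable (A i)) ->
  lebesgue_tuple R n [set t | forall i, A i (tnth t i)] =
  (\prod_(i < n) lebesgue_measure (A i))%E.
Proof.
elim: n A => [|n ih] A mA.
  by rewrite big_ord0 /= diracE mem_set// => -[].
have mB : measurable [set t : n.-tuple _ | forall i, A (lift ord0 i) (tnth t i)].
  rewrite (_ : mkset _ = \bigcap_(i in [set: 'I_n])
      ((fun t : n.-tuple _ => tnth t i) @^-1` A (lift ord0 i))).
    apply: fin_bigcap_measurable => // i _.
    by rewrite -[_ @^-1` _]setTI; exact: measurable_tnth.
  by apply/seteqP; split=> t /= h i; [move=> _|]; exact: h.
rewrite big_ord_recl -ih// -product_measure1E//.
rewrite /=/lebesgue_cons /pushforward; congr (_ _).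
apply/seteqP; split=> -[x t] /=.
  move=> h; split; first exact: (h ord0).
  by move=> i; have := h (lift ord0 i); rewrite tnthS.
by move=> [h0 h1] i; case: (unliftP ord0 i) => [j ->|->//]; rewrite tnthS.
Qed.

Section lebesgue_ffun.
Context {R : realType} {I : finType}.
Local Open Scope ereal_scope.
Local Notation mR := (measurableTypeR R).

Definition ffun_of_tuple (t : #|I|.-tuple mR) : {ffun I -> R} :=
  [ffun i => tnth t (enum_rank i)].

Lemma measurable_ffun_of_tuple :
  measurable_fun [set: #|I|.-tuple mR] ffun_of_tuple.
Proof.
apply/measurable_ffunP => i /=.
rewrite (_ : (fun t => _) = (fun t => tnth t (enum_rank i))).
  exact: measurable_tnth.
by apply/funext => t; rewrite ffunE.
Qed.

Definition lebesgue_ffun : set {ffun I -> R} -> \bar R :=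
  pushforward (lebesgue_tuple R #|I|) ffun_of_tuple.

Let mfot (A : set {ffun I -> R}) :
  measurable A -> measurable (ffun_of_tuple @^-1` A).
Proof. by move=> mA; rewrite -[_ @^-1` _]setTI; exact: measurable_ffun_of_tuple. Qed.

Let lebesgue_ffun0 : lebesgue_ffun set0 = 0.
Proof. by rewrite /lebesgue_ffun /pushforward preimage_set0 measure0. Qed.

Let lebesgue_ffun_ge0 A : 0 <= lebesgue_ffun A.
Proof. by rewrite /lebesgue_ffun /pushforward measure_ge0. Qed.

Let lebesgue_ffun_sigma_additive : semi_sigma_additive lebesgue_ffun.
Proof.
move=> F mF tF mUF; rewrite /lebesgue_ffun /pushforward preimage_bigcup.
apply: measure_semi_sigma_additive.
- by move=> i; exact: mfot.
- apply/trivIsetP => /= i j _ _ ij; rewrite -preimage_setI.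
  by move/trivIsetP : tF => /(_ _ _ _ _ ij) ->//; rewrite preimage_set0.
- by rewrite -preimage_bigcup; exact: mfot.
Qed.

HB.instance Definition _ := isMeasure.Build _ _ _ lebesgue_ffun
  lebesgue_ffun0 lebesgue_ffun_ge0 lebesgue_ffun_sigma_additive.

Lemma lebesgue_ffun_box (A : I -> set R) : (forall i, measurable (A i)) ->
  lebesgue_ffun [set x | forall i, A i (x i)] =
  \prod_(i : I) lebesgue_measure (A i).
Proof.
move=> mA; rewrite (reindex (fun k : 'I_#|I| => enum_val k)); last first.
  by apply: onW_bij; exists enum_rank; [exact: enum_valK|exact: enum_rankK].
rewrite -lebesgue_tuple_box => [|k]; last exact: mA.
rewrite /lebesgue_ffun /pushforward.
apply: (congr1 (lebesgue_tuple R #|I|)).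
apply/seteqP; split=> t /= h i.
  by have := h (enum_val i); rewrite ffunE enum_valK.
by rewrite ffunE -{1}(enum_rankK i); exact: h.
Qed.

End lebesgue_ffun.

Section norms.
Context {R : realType}.

(* The value at [-oo] is junk. *)
Definition lp_norm (p : \bar R) (J : finType) (v : {ffun J -> R}) : R :=
  match p with
  | r%:E => (\sum_j `|v j| `^ r) `^ r^-1
  | +oo%E => \big[Num.max/0]_j `|v j|
  | -oo%E => 0
  end.

(* Restricting by zero off [Om] gives the norm with respect to Lebesgue
   measure on [Om], also for [p = +oo]. *)
Definition Lp_norm (I J : finType) (p : \bar R) (Om : set {ffun I -> R})
    (f : {ffun I -> R} -> {ffun J -> R}) : \bar R :=
  'N[lebesgue_ffun]_p [ (fun x => (lp_norm p (f x))%:E) \_ Om ].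

(* [n^(1/p)], with the convention [n^(1/oo) = 1] *)
Definition root_of (p : \bar R) (n : nat) : R :=
  if p is r%:E then n%:R `^ r^-1 else 1.

End norms.

Section group_action.
Context {R : realType} {gT : finGroupType}.

Definition channel (I : finType) (x : {ffun I * gT -> R}) (i : I) :
  {ffun gT -> R} := [ffun g => x (i, g)].

Definition translate (g : gT) (y : {ffun gT -> R}) : {ffun gT -> R} :=
  [ffun h => y (g^-1 * h)%g].

Definition translate_vec (I : finType) (g : gT) (x : {ffun I * gT -> R}) :
  {ffun I * gT -> R} := [ffun u => translate g (channel x u.1) u.2].

Definition equivariant (I J : finType)
    (F : {ffun I * gT -> R} -> {ffun J * gT -> R}) : Prop :=
  forall g, F \o translate_vec g = translate_vec g \o F.

Definition G_invariant (I : finType) (Om : set {ffun I * gT -> R}) : Prop :=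
  forall g, translate_vec g @` Om `<=` Om.

Definition at_one (X : Type) (J : finType) (F : X -> {ffun J * gT -> R})
  (x : X) : {ffun J -> R} := [ffun j => F x (j, 1%g)].

Definition convolution (a b : {ffun gT -> R}) : {ffun gT -> R} :=
  [ffun g => \sum_h a h * b (h^-1 * g)%g].

End group_action.

Definition l0 (R : realType) (J : finType) (v : {ffun J -> R}) : nat :=
  #|[pred j | v j != 0]|.

(* [x |-> aff_bias + A x], where [aff_mat (j, i)] is the entry of the matrix
   of [A] in row [j] and column [i]. *)
Record affine (R : realType) (I J : finType) := Affine {
  aff_bias : {ffun J -> R};
  aff_mat : {ffun J * I -> R} }.

Section affine_maps.
Context {R : realType}.

Definition aff_fun (I J : finType) (V : affine R I J) (x : {ffun I -> R}) :
  {ffun J -> R} := [ffun j => aff_bias V j + \sum_i aff_mat V (j, i) * x i].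

Definition aff_l0 (I J : finType) (V : affine R I J) : nat :=
  (l0 (aff_bias V) + l0 (aff_mat V))%N.

Definition componentwise (rho : R -> R) (I : finType) (x : {ffun I -> R}) :
  {ffun I -> R} := [ffun i => rho (x i)].

End affine_maps.

(* [fnn R N I [:: N1; ..; N(L-1)]] is the type of tuples [(V1, .., VL)] of
   affine maps [R^I -> R^N1 -> .. -> R^N(L-1) -> R^N]. *)
Inductive fnn (R : realType) (N : nat) (I : finType) : seq nat -> Type :=
| fnn_last of affine R I 'I_N : fnn R N I [::]
| fnn_layer (n : nat) (Ns : seq nat) of affine R I 'I_n & fnn R N 'I_n Ns :
    fnn R N I (n :: Ns).

Section fnn.
Context {R : realType} {N : nat}.

Fixpoint fnn_real (rho : R -> R) (I : finType) (Ns : seq nat)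
    (Phi : fnn R N I Ns) : {ffun I -> R} -> {ffun 'I_N -> R} :=
  match Phi with
  | fnn_last V => aff_fun V
  | fnn_layer _ _ V Phi' =>
      fun x => fnn_real rho Phi' (componentwise rho (aff_fun V x))
  end.

Fixpoint fnn_weight (I : finType) (Ns : seq nat) (Phi : fnn R N I Ns) : nat :=
  match Phi with
  | fnn_last V => aff_l0 V
  | fnn_layer _ _ V Phi' => (aff_l0 V + fnn_weight Phi')%N
  end.

End fnn.

Section convolutional_maps.
Context {R : realType} {gT : finGroupType}.

Definition filtering (k C : nat) (a : 'I_k -> {ffun gT -> R})
    (x : {ffun 'I_C * gT -> R}) : {ffun ('I_k * 'I_C) * gT -> R} :=
  [ffun u => convolution (channel x u.1.2) (a u.1.1) u.2].

Definition lift_map (J I : finType) (A : {ffun J -> R} -> {ffun I -> R})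
    (x : {ffun J * gT -> R}) : {ffun I * gT -> R} :=
  [ffun u => A [ffun j => x (j, u.2)] u.1].

(* The weight of a filtering map is the number of nonzero entries of its
   filters; these are determined by the map as soon as [0 < C1]. *)
Definition conv_rep (k C1 C2 : nat)
    (T : {ffun 'I_C1 * gT -> R} -> {ffun 'I_C2 * gT -> R}) (w : nat) : Prop :=
  exists (A : affine R ('I_k * 'I_C1)%type 'I_C2) (a : 'I_k -> {ffun gT -> R}),
    T = lift_map (aff_fun A) \o filtering a /\
    w = (aff_l0 A + \sum_(r < k) l0 (a r))%N.

End convolutional_maps.

Record conv_map (R : realType) (gT : finGroupType) (k C1 C2 : nat) := ConvMap {
  conv_fun :> {ffun 'I_C1 * gT -> R} -> {ffun 'I_C2 * gT -> R};
  conv_funP : exists w, conv_rep k conv_fun w }.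

Lemma conv_map_ex (R : realType) (gT : finGroupType) (k C1 C2 : nat)
    (T : conv_map R gT k C1 C2) : exists w, `[< conv_rep k T w >].
Proof. by case: T => T [w Tw]; exists w; apply/asboolP. Qed.

Definition conv_l0 (R : realType) (gT : finGroupType) (k C1 C2 : nat)
  (T : conv_map R gT k C1 C2) : nat := ex_minn (conv_map_ex T).

(* [cnn R gT N C [:: C1; ..; C(L-1)] [:: k1; ..; kL]] is the type of
   convolutional networks with channel counts [(C, C1, .., C(L-1), N)] and
   filter counts [(k1, .., kL)]. *)
Inductive cnn (R : realType) (gT : finGroupType) (N C : nat) :
    seq nat -> seq nat -> Type :=
| cnn_last (k : nat) of conv_map R gT k C N : cnn R gT N C [::] [:: k]
| cnn_layer (k C' : nat) (Cs ks : seq nat) of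
    conv_map R gT k C C' & cnn R gT N C' Cs ks :
    cnn R gT N C (C' :: Cs) (k :: ks).

Section cnn.
Context {R : realType} {gT : finGroupType} {N : nat}.

Fixpoint cnn_real (rho : R -> R) (C : nat) (Cs ks : seq nat)
    (Psi : cnn R gT N C Cs ks) :
    {ffun 'I_C * gT -> R} -> {ffun 'I_N * gT -> R} :=
  match Psi with
  | cnn_last _ T => T
  | cnn_layer _ _ _ _ T Psi' =>
      fun x => cnn_real rho Psi' (componentwise rho (T x))
  end.

Fixpoint cnn_weight (C : nat) (Cs ks : seq nat) (Psi : cnn R gT N C Cs ks) :
    nat :=
  match Psi with
  | cnn_last _ T => conv_l0 T
  | cnn_layer _ _ _ _ T Psi' => (conv_l0 T + cnn_weight Psi')%N
  end.

End cnn.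

(* Main.v *)
Require Import Defs.
From HB Require Import structures.
From mathcomp Require Import all_boot all_order all_algebra all_fingroup.
From mathcomp Require Import all_classical all_reals all_analysis.
From mathcomp Require Import measurable_realfun ess_sup_inf.

Set Implicit Arguments.
Unset Strict Implicit.
Unset Printing Implicit Defensive.

Import Order.TTheory GRing.Theory Num.Theory.
Import numFieldNormedType.Exports.

Local Open Scope classical_set_scope.
Local Open Scope ring_scope.

(** The idea is to run [Phi] at every point of the orbit of the input under
translation.  A network [Psi] is built with
[(R(Psi) x)_(i, g) = (R(Phi) (translate_vec g^-1 x))_i] ([cnn_of_fnn]).  Since
[F] is equivariant, [F] satisfies the same identity with [at_one F] in place
of [R(Phi)], so that the error of [Psi] at [(., g)] and [x] is the error of
[Phi] at the translate of [x] by [g^-1].  Translations permute the coordinates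
of [x]; they preserve Lebesgue measure ([lebesgue_ffun_translate]) and [Omega],
so every [g] contributes the same amount to the [p]-th power of the norm,
whence the factor [|G|^(1/p)]; for [p = +oo] a maximum replaces the sum and no
factor appears ([Lp_norm_orbit]).

The network itself: the first layer [V] of [Phi] is evaluated on the
translates of [x] by means of one filter per pair of an output and an input
channel, namely [h |-> A(i, (j, h^-1))] with [A] the matrix of [V]; the
subsequent affine map only adds up, over the input channels, the convolutions
meant for its output ([first_layer]).  The filters have as many nonzero entries
as [A].  The affine map needs a coefficient for the nonzero filters only, hence
no more than [A] has nonzero entries; this gives the factor 2.  The other
layers act separately at each [g], through the filter that is the unit of
convolution, which costs one weight more ([pointwise_layer]); if [V] is zero,
its weight 0 does not leave room for this, and the zero filter is used. *)

(** * Lebesgue measure and permutations of the coordinates *)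

Section lebesgue_perm.
Context {R : realType} {I : finType}.
Local Open Scope ereal_scope.

(** Products of measurable sets of reals: a pi-system generating the
sigma-algebra. *)
Definition boxes : set (set {ffun I -> R}) :=
  [set B | exists2 A : I -> set R, (forall i, measurable (A i)) &
     B = [set x : {ffun I -> R} | forall i, A i (x i)]].

Lemma boxes_setI : setI_closed boxes.
Proof.
move=> _ _ [A mA ->] [B mB ->]; exists (fun i => A i `&` B i).
  by move=> i; exact: measurableI.
apply/seteqP; split=> x /=; first by move=> [hA hB] i; split.
by move=> h; split=> i; have [] := h i.
Qed.

Lemma measurable_box (A : I -> set R) : (forall i, measurable (A i)) ->
  measurable [set x : {ffun I -> R} | forall i, A i (x i)].
Proof.
move=> mA; rewrite (_ : mkset _ =
    \bigcap_(i in [set: I]) ((fun x : {ffun I -> R} => x i) @^-1` A i)).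
  apply: fin_bigcap_measurable => // i _.
  by rewrite -[_ @^-1` _]setTI; exact: measurable_ffun_coord.
by apply/seteqP; split=> x /= h i; [move=> _|]; exact: h.
Qed.

Lemma measurable_boxes :
  (measurable : set (set {ffun I -> R})) = <<s boxes >>.
Proof.
apply/seteqP; split.
  apply: smallest_sub; first exact: smallest_sigma_algebra.
  move=> _ [i [B mB ->]]; apply: sub_sigma_algebra.
  exists (fun j => if j == i then B else setT).
    by move=> j; case: ifP => // _.
  apply/seteqP; split=> x /=; last by move=> /(_ i); rewrite eqxx.
  by move=> xB j; case: eqP => // ->.
apply: smallest_sub; first exact: sigma_algebra_measurable.
by move=> _ [A mA ->]; exact: measurable_box.
Qed.

(** Lebesgue measure is determined by its values on boxes; the cubes
[`]-k, k[^I] witness sigma-finiteness. *)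
Lemma lebesgue_ffun_unique (m : {measure set {ffun I -> R} -> \bar R}) :
  (forall A : I -> set R, (forall i, measurable (A i)) ->
     m [set x : {ffun I -> R} | forall i, A i (x i)] =
     \prod_i lebesgue_measure (A i)) ->
  forall A, measurable A -> lebesgue_ffun A = m A.
Proof.
move=> mbox.
pose g k : set {ffun I -> R} :=
  [set x | forall i, `](- k%:R)%R, k%:R[%classic (x i)].
move=> A mA.
apply: (@measure_unique _ R _ boxes g _ _ _ _ lebesgue_ffun m) => //.
- exact: measurable_boxes.
- exact: boxes_setI.
- move=> k; exists (fun=> `](- k%:R)%R, k%:R[%classic) => //.
- apply/seteqP; split=> // x _.
  have xb i : exists k : nat, (`|x i| < k%:R)%R.
    by exists (Num.bound `|x i|); rewrite archi_boundP.
  pose k i := projT1 (cid (xb i)).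
  exists (\max_i k i)%N => // i /=; rewrite in_itv/= -ltr_norml.
  apply: (lt_le_trans (projT2 (cid (xb i)))); rewrite ler_nat.
  exact: (leq_bigmax i).
- by move=> _ [B mB ->]; rewrite mbox//; exact: lebesgue_ffun_box.
- move=> k.
  suff : \prod_(i : I) @lebesgue_measure R `](- k%:R)%R, k%:R[%classic < +oo.
    by rewrite -lebesgue_ffun_box.
  rewrite ltey_eq; apply/orP; left.
  apply: (big_ind (fun x : \bar R => x \is a fin_num)) => //.
    exact: fin_numM.
  by move=> i _; rewrite lebesgue_measure_itv/=; case: ifP.
Qed.

(** The substitution of coordinates along [s]. *)
Definition reindex_ffun (s : I -> I) (x : {ffun I -> R}) : {ffun I -> R} :=
  [ffun i => x (s i)].

Lemma measurable_reindex_ffun s :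
  measurable_fun [set: {ffun I -> R}] (reindex_ffun s).
Proof.
apply/measurable_ffunP => i; under eq_fun do rewrite ffunE.
exact: measurable_ffun_coord.
Qed.

Lemma lebesgue_ffun_reindex s A : injective s -> measurable A ->
  lebesgue_ffun (reindex_ffun s @^-1` A) = lebesgue_ffun A.
Proof.
move=> sI mA.
pose mphi := isMeasurableFun.Build _ _ _ _ _ (measurable_reindex_ffun s).
pose phi : {mfun {ffun I -> R} >-> {ffun I -> R}} :=
  HB.pack (reindex_ffun s) mphi.
apply/esym/(@lebesgue_ffun_unique (pushforward lebesgue_ffun phi)) => //.
move=> B mB; have [t sK tK] := injF_bij sI.
transitivity (\prod_i lebesgue_measure (B (t i))); last first.
  rewrite (reindex s)//=; last by apply: onW_bij; exists t.
  by apply: eq_bigr => i _; rewrite sK.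
rewrite -lebesgue_ffun_box//; congr (lebesgue_ffun _).
apply/seteqP; split=> x /= h i.
  by have := h (t i); rewrite ffunE tK.
by rewrite ffunE; have := h (s i); rewrite sK.
Qed.

End lebesgue_perm.

(** * Construction of the convolutional network *)

Lemma big_prod (T : Type) (idx : T) (op : Monoid.com_law idx) (I J : finType)
    (f : I * J -> T) :
  \big[op/idx]_u f u = \big[op/idx]_i \big[op/idx]_j f (i, j).
Proof. by rewrite pair_bigA; apply: eq_bigr => -[]. Qed.

Section conv_layers.
Context {R : realType} {gT : finGroupType}.

Lemma translate_vecE (I : finType) (g : gT) (x : {ffun I * gT -> R}) i h :
  translate_vec g x (i, h) = x (i, (g^-1 * h)%g).
Proof. by rewrite !ffunE. Qed.

Lemma l0E (J : finType) (v : {ffun J -> R}) : l0 v = (\sum_j (v j != 0)%R)%N.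
Proof.
rewrite /l0 -sum1_card [LHS]big_mkcond; apply: eq_bigr => j _.
by rewrite inE; case: eqP.
Qed.

Lemma conv_l0_le (k C1 C2 : nat) (T : conv_map R gT k C1 C2) w :
  conv_rep k T w -> (conv_l0 T <= w)%N.
Proof.
by move=> Tw; rewrite /conv_l0; case: ex_minnP => m _; apply; apply/asboolP.
Qed.

Lemma conv_layer_exists (k C1 C2 : nat) (A : affine R ('I_k * 'I_C1)%type 'I_C2)
    (a : 'I_k -> {ffun gT -> R}) :
  exists T : conv_map R gT k C1 C2,
    T =1 lift_map (aff_fun A) \o filtering a /\
    (conv_l0 T <= aff_l0 A + \sum_(r < k) l0 (a r))%N.
Proof.
have rep : conv_rep k (lift_map (aff_fun A) \o filtering a)
    (aff_l0 A + \sum_(r < k) l0 (a r))%N by exists A, a.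
exists (ConvMap (ex_intro _ _ rep)); split => //.
exact: conv_l0_le.
Qed.

(** The neutral element for convolution, supported at the identity. *)
Definition unit_filter : {ffun gT -> R} := [ffun h => (h == 1%g)%:R].

Lemma convolution_unit (y : {ffun gT -> R}) : convolution y unit_filter = y.
Proof.
apply/ffunP => g; rewrite ffunE (bigD1 g)//= ffunE mulVg eqxx mulr1.
rewrite big1 ?addr0// => h hg; rewrite ffunE -eq_invg_mul invgK (negbTE hg).
by rewrite mulr0.
Qed.

Lemma l0_unit_filter : l0 unit_filter = 1%N.
Proof.
rewrite l0E (bigD1 1%g)//= ffunE eqxx oner_eq0 big1// => h /negbTE h1.
by rewrite ffunE h1 eqxx.
Qed.

Lemma l0_zero (J : finType) : l0 (0 : {ffun J -> R}) = 0%N.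
Proof. by rewrite l0E big1// => j _; rewrite ffunE eqxx. Qed.

Lemma l0_eq0 (J : finType) (v : {ffun J -> R}) : l0 v = 0%N -> v = 0.
Proof.
rewrite l0E => /eqP; rewrite sum_nat_eq0 => /forallP h.
by apply/ffunP => j; rewrite [RHS]ffunE; move: (h j); case: (v j =P 0).
Qed.

(** A layer acting separately at each group element. *)
Lemma pointwise_layer (n m : nat) (V : affine R 'I_n 'I_m) :
  exists T : conv_map R gT 1 n m,
    (forall x i g, T x (i, g) = aff_fun V [ffun j => x (j, g)] i) /\
    (conv_l0 T <= 2 * aff_l0 V)%N.
Proof.
pose A := Affine (aff_bias V)
  [ffun u : 'I_m * ('I_1 * 'I_n) => aff_mat V (u.1, u.2.2)].
(* The unit filter would exceed a bound of zero when [V] is zero. *)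
pose a (_ : 'I_1) := if aff_l0 V == 0%N then 0 else unit_filter.
have [T [TE Tl]] := conv_layer_exists A a; exists T; split.
  move=> x i g; rewrite TE ffunE/= ffunE /= [RHS]ffunE; congr (_ + _).
  rewrite big_prod/= big_ord1.
  apply: eq_bigr => j _; rewrite !ffunE/= /a; case: eqP => [|_].
    move=> /eqP; rewrite addn_eq0 => /andP[_ /eqP/l0_eq0->].
    by rewrite !ffunE !mul0r.
  by have /ffunP/(_ g) := convolution_unit (channel x j); rewrite !ffunE => ->.
apply: (leq_trans Tl); rewrite big_ord1 mul2n -addnn leq_add//.
  rewrite leq_add// !l0E big_prod big_prod leq_sum// => i _.
  by rewrite big_prod big_ord1 leq_sum// => j _; rewrite ffunE.
by rewrite /a; case: eqP => [_|/eqP]; rewrite ?l0_zero// l0_unit_filter lt0n.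
Qed.

(** A layer evaluating an arbitrary affine map on all translates of the
input. *)
Lemma first_layer (C n : nat) (V : affine R ('I_C * gT)%type 'I_n) :
  exists T : conv_map R gT (n * C) C n,
    (forall x i g, T x (i, g) = aff_fun V (translate_vec g^-1%g x) i) /\
    (conv_l0 T <= 2 * aff_l0 V)%N.
Proof.
(* Filters are numbered by pairs of an output and an input channel. *)
pose e (u : 'I_n * 'I_C) : 'I_(n * C) := mxvec_index u.1 u.2.
pose d (r : 'I_(n * C)) : 'I_n * 'I_C :=
  enum_val (cast_ord (esym (mxvec_cast n C)) r).
have eK : cancel e d.
  by case=> i j; rewrite /e /d /mxvec_index cast_ordK enum_rankK.
have dK : cancel d e.
  by move=> r; case: (mxvec_indexP r) => i j; exact: (congr1 e (eK (i, j))).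
pose a (r : 'I_(n * C)) : {ffun gT -> R} :=
  [ffun h => aff_mat V ((d r).1, ((d r).2, h^-1%g))].
(* Coefficients belonging to zero filters are dropped, to save weights. *)
pose A := Affine (aff_bias V)
  [ffun u : 'I_n * ('I_(n * C) * 'I_C) =>
     ((u.2.1 == e (u.1, u.2.2)) && (a u.2.1 != 0))%:R].
have [T [TE Tl]] := conv_layer_exists A a; exists T; split.
  move=> x i g; rewrite TE ffunE/= ffunE /= [RHS]ffunE; congr (_ + _).
  rewrite big_prod/= exchange_big/= big_prod/=.
  apply: eq_bigr => j _.
  rewrite (bigD1 (e (i, j)))//= big1 ?addr0 => [|r /negbTE re]; last first.
    by rewrite ffunE/= re mul0r.
  rewrite !ffunE/= eqxx/=.
  transitivity (convolution (channel x j) (a (e (i, j))) g).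
    case: eqP => [->|_]; last by rewrite mul1r [RHS]ffunE.
    by rewrite mul0r [RHS]ffunE big1// => h _; rewrite [X in _ * X]ffunE mulr0.
  rewrite ffunE (reindex_inj (mulgI g)); apply: eq_bigr => h _.
  by rewrite translate_vecE !ffunE eK invMg !invgK mulKg mulrC.
apply: (leq_trans Tl).
have suma : (\sum_(r < n * C) l0 (a r) = l0 (aff_mat V))%N.
  rewrite l0E big_prod/=.
  rewrite (reindex e); last by apply: onW_bij; exists d.
  rewrite big_prod/=; apply: eq_bigr => i _.
  rewrite big_prod/=; apply: eq_bigr => j _; rewrite l0E (reindex_inj invg_inj).
  by apply: eq_bigr => h _; rewrite ffunE eK invgK.
rewrite suma mul2n -addnn; rewrite leq_add//; last exact: leq_addl.
(* Each row of [A] has at most one nonzero entry per input channel, and none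
   at all for a zero filter. *)
rewrite leq_add2l -suma l0E big_prod/=.
rewrite (reindex e); last by apply: onW_bij; exists d.
rewrite big_prod/=; apply: leq_sum => i _.
rewrite big_prod/= exchange_big/=; apply: leq_sum => j _.
rewrite (bigD1 (e (i, j)))//= big1 ?addn0 => [|r /negbTE re]; last first.
  by rewrite ffunE/= re eqxx.
rewrite ffunE/= eqxx/=; case: eqVneq => [_|a0]; rewrite ?eqxx//=.
by rewrite lt0n; apply: contra a0 => /eqP/l0_eq0 ->; rewrite eqxx.
Qed.

(** Inversion along the list of widths. *)
Lemma fnn_inv (N : nat) (I : finType) (Ns : seq nat) (Phi : fnn R N I Ns) :
  match Ns return fnn R N I Ns -> Prop with
  | [::] => fun Phi => exists V, Phi = fnn_last V
  | n :: Ns' => fun Phi =>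
      exists V (Phi' : fnn R N 'I_n Ns'), Phi = fnn_layer V Phi'
  end Phi.
Proof. by case: Phi => *; repeat eexists. Qed.

(** [Phi] applied separately at each group element. *)
Lemma pointwise_cnn (N n : nat) (Ns : seq nat) (rho : R -> R)
    (Phi : fnn R N 'I_n Ns) :
  exists Psi : cnn R gT N n Ns (nseq (size Ns).+1 1%N),
    (forall x i g, cnn_real rho Psi x (i, g) =
       fnn_real rho Phi [ffun j => x (j, g)] i) /\
    (cnn_weight Psi <= 2 * fnn_weight Phi)%N.
Proof.
elim: Ns n Phi => [|m Ns ih] n Phi.
  have [V ->] := fnn_inv Phi; have [T TP] := pointwise_layer V.
  by exists (cnn_last T).
have [V [Phi' ->]] := fnn_inv Phi; have [T [TE Tl]] := pointwise_layer V.
have [Psi [PsiE Psil]] := ih _ Phi'; exists (cnn_layer T Psi); split => /=.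
  move=> x i g; rewrite PsiE; congr (fnn_real _ _ _ _).
  by apply/ffunP => j; rewrite !ffunE TE ffunE.
by rewrite mulnDr leq_add.
Qed.

(** [Phi] applied to all translates of the input, at no more than twice its
weight. *)
Lemma cnn_of_fnn (N C : nat) (Ns : seq nat) (rho : R -> R)
    (Phi : fnn R N ('I_C * gT)%type Ns) :
  exists Psi : cnn R gT N C Ns ((head N Ns * C)%N :: nseq (size Ns) 1%N),
    (forall x i g, cnn_real rho Psi x (i, g) =
       fnn_real rho Phi (translate_vec g^-1%g x) i) /\
    (cnn_weight Psi <= 2 * fnn_weight Phi)%N.
Proof.
case: Ns Phi => [|m Ns] Phi.
  have [V ->] := fnn_inv Phi; have [T TP] := first_layer V.
  by exists (cnn_last T).
have [V [Phi' ->]] := fnn_inv Phi; have [T [TE Tl]] := first_layer V.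
have [Psi [PsiE Psil]] := pointwise_cnn rho Phi'.
exists (cnn_layer T Psi); split => /=.
  move=> x i g; rewrite PsiE; congr (fnn_real _ _ _ _).
  by apply/ffunP => j; rewrite !ffunE TE ffunE.
by rewrite mulnDr leq_add.
Qed.

End conv_layers.

(** * Measurability *)

Section measurability.
Context {R : realType}.

Lemma measurable_aff_fun (I J : finType) (V : affine R I J) :
  measurable_fun [set: {ffun I -> R}] (aff_fun V).
Proof.
apply/measurable_ffunP => j; under eq_fun do rewrite ffunE.
apply: measurable_funD; first exact: measurable_cst.
apply: measurable_sum => i; apply: measurable_funM; first exact: measurable_cst.
exact: measurable_ffun_coord.
Qed.

Lemma measurable_componentwise (rho : R -> R) (I : finType) :
  measurable_fun [set: R] rho ->
  measurable_fun [set: {ffun I -> R}] (componentwise rho (I := I)).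
Proof.
move=> mrho; apply/measurable_ffunP => i; under eq_fun do rewrite ffunE.
by apply: measurableT_comp => //; exact: measurable_ffun_coord.
Qed.

Lemma measurable_fnn_real (rho : R -> R) (N : nat) (I : finType) (Ns : seq nat)
    (Phi : fnn R N I Ns) : measurable_fun [set: R] rho ->
  measurable_fun [set: {ffun I -> R}] (fnn_real rho Phi).
Proof.
move=> mrho; elim: Phi => [{}I V|{}I n {}Ns V Phi ih] /=.
  exact: measurable_aff_fun.
apply: measurableT_comp => //; apply: measurableT_comp.
  exact: measurable_componentwise.
exact: measurable_aff_fun.
Qed.

Lemma measurable_ffunB d (T : measurableType d) (J : finType)
    (f h : T -> {ffun J -> R}) :
  measurable_fun [set: T] f -> measurable_fun [set: T] h ->
  measurable_fun [set: T] (fun x => f x - h x).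
Proof.
move=> mf mh; apply/measurable_ffunP => j; under eq_fun do rewrite !ffunE.
apply: measurable_funB.
- by apply: (measurableT_comp (measurable_ffun_coord (I := J) j) mf).
- by apply: (measurableT_comp (measurable_ffun_coord (I := J) j) mh).
Qed.

Lemma measurable_lp_norm (p : \bar R) (J : finType) :
  measurable_fun [set: {ffun J -> R}] (lp_norm p (J := J)).
Proof.
rewrite /lp_norm; case: p => [r||]; last exact: measurable_cst.
  apply: (measurableT_comp (measurable_powR _)); apply: measurable_sum => j.
  apply: (measurableT_comp (measurable_powR _)).
  by apply: measurableT_comp => //; exact: measurable_ffun_coord.
elim: (index_enum J) => [|j s ih].
  under [X in measurable_fun _ X]eq_fun do rewrite big_nil.
  exact: measurable_cst.
under [X in measurable_fun _ X]eq_fun do rewrite big_cons.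
apply: measurable_maxr => //.
by apply: measurableT_comp => //; exact: measurable_ffun_coord.
Qed.

End measurability.

(** * Norms of functions determined by one component *)

Section lp_norm.
Context {R : realType}.
Implicit Type J : finType.

Lemma lp_norm_ge0 (p : \bar R) J (v : {ffun J -> R}) : 0 <= lp_norm p v.
Proof.
case: p => [r||] //=; first exact: powR_ge0.
by elim/big_ind: _ => // x y x0 y0; rewrite le_max x0.
Qed.

Lemma powR_lp_norm (r : R) J (v : {ffun J -> R}) : 0 < r ->
  lp_norm r%:E v `^ r = \sum_j `|v j| `^ r.
Proof.
move=> r0; rewrite /= -powRrM mulVf ?gt_eqF// powRr1//.
by apply: sumr_ge0 => j _; exact: powR_ge0.
Qed.

End lp_norm.

Section translation.
Context {R : realType} {gT : finGroupType} {I : finType}.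
Local Notation X := {ffun I * gT -> R}.
Implicit Type g : gT.

Lemma translate_vec_reindex g :
  @translate_vec R gT I g = reindex_ffun (fun u => (u.1, (g^-1 * u.2)%g)).
Proof. by apply/funext => x; apply/ffunP => -[i h]; rewrite !ffunE. Qed.

Lemma measurable_translate_vec g : measurable_fun [set: X] (translate_vec g).
Proof. rewrite translate_vec_reindex; exact: measurable_reindex_ffun. Qed.

Lemma lebesgue_ffun_translate g (A : set X) : measurable A ->
  lebesgue_ffun (translate_vec g @^-1` A) = lebesgue_ffun A.
Proof.
move=> mA; rewrite translate_vec_reindex; apply: lebesgue_ffun_reindex => //.
by move=> [i h] [j k] /= [-> /mulgI ->].
Qed.

Lemma translate_vecK g :
  cancel (@translate_vec R gT I g) (translate_vec g^-1%g).
Proof.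
by move=> x; apply/ffunP => -[i h]; rewrite !translate_vecE invgK mulKg.
Qed.

Lemma mem_translate (Om : set X) g x : G_invariant Om ->
  (translate_vec g x \in Om) = (x \in Om).
Proof.
move=> Om_inv; apply/idP/idP; rewrite !inE => Ox.
  by apply: (Om_inv g^-1%g); exists (translate_vec g x) => //;
    exact: translate_vecK.
by apply: (Om_inv g); exists x.
Qed.

Lemma ge0_integral_translate g (h : X -> \bar R) :
  measurable_fun [set: X] h -> (forall x, 0 <= h x)%E ->
  (\int[lebesgue_ffun]_x h (translate_vec g x) = \int[lebesgue_ffun]_x h x)%E.
Proof.
move=> mh h0.
pose mphi := isMeasurableFun.Build _ _ _ _ _ (measurable_translate_vec g).
pose phi : {mfun X >-> X} := HB.pack (translate_vec g) mphi.
rewrite -[LHS](@ge0_integral_pushforward _ _ _ _ _ phi _ lebesgue_ffun setT)//.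
apply: eq_measure_integral => A mA _; exact: lebesgue_ffun_translate.
Qed.

Lemma ae_translate g (P : set X) :
  (\forall x \ae lebesgue_ffun, P x) ->
  (\forall x \ae lebesgue_ffun, P (translate_vec g x)).
Proof.
move=> [N [mN N0 sub]]; exists (translate_vec g @^-1` N); split.
- by rewrite -[_ @^-1` _]setTI; exact: measurable_translate_vec.
- by rewrite -N0; exact: lebesgue_ffun_translate.
- by move=> x; exact: sub.
Qed.

(** If the component of [f] at [g] is [f1] evaluated at the translate by
[g^-1], then the norm of [f] is controlled by that of [f1]. *)
Lemma Lp_norm_orbit (J : finType) (p : \bar R) (Om : set X)
    (f : X -> {ffun J * gT -> R}) (f1 : X -> {ffun J -> R}) :
  (0 < p)%E -> G_invariant Om -> measurable Om -> measurable_fun [set: X] f1 ->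
  (forall x j g, f x (j, g) = f1 (translate_vec g^-1%g x) j) ->
  (Lp_norm p Om f <= (root_of p #|gT|)%:E * Lp_norm p Om f1)%E.
Proof.
move=> p0 Om_inv mOm mf1 fE.
pose h1 : X -> \bar R := (fun x => (lp_norm p (f1 x))%:E) \_ Om.
have mh1 : measurable_fun [set: X] h1.
  apply/(measurable_restrictT _ _).1 => //; apply/measurable_EFinP.
  apply: measurable_funS (measurableT) _ _ => //.
  apply: measurableT_comp mf1; exact: measurable_lp_norm.
have h10 x : (0 <= h1 x)%E.
  by rewrite /h1 patchE; case: ifP => // _; rewrite lee_fin lp_norm_ge0.
have memE g x : (translate_vec g x \in Om) = (x \in Om) by exact: mem_translate.
rewrite /Lp_norm unlock -/h1; case: p p0 @h1 mh1 h10 => [r r0|_|//] h1 mh1 h10.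
  (* The [r]-th power of the integrand for [f] is the sum over the group of
     the translates of the one for [f1]. *)
  pose h2 x := (`|h1 x| `^ r)%E.
  have h20 x : (0 <= h2 x)%E by exact: poweR_ge0.
  have mh2 : measurable_fun [set: X] h2.
    apply: (measurableT_comp (measurable_poweR _)).
    apply: measurableT_comp mh1; exact: abse_measurable.
  have hE x : (`|((fun x => (lp_norm r%:E (f x))%:E) \_ Om) x| `^ r =
      \sum_(g : gT) h2 (translate_vec g^-1%g x))%E.
    under eq_bigr do rewrite /h2 /h1 patchE memE.
    rewrite patchE; case: ifP => _.
      under eq_bigr do
        rewrite gee0_abs ?lee_fin ?lp_norm_ge0// poweR_EFin powR_lp_norm//.
      rewrite gee0_abs ?lee_fin ?lp_norm_ge0// poweR_EFin powR_lp_norm//.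
      rewrite sumEFin big_prod exchange_big/=; congr EFin.
      by apply: eq_bigr => g _; apply: eq_bigr => j _; rewrite fE.
    by rewrite big1 => [|g _]; rewrite abse0 poweR0r ?gt_eqF.
  under eq_integral do rewrite hE.
  rewrite (ge0_integral_sum lebesgue_ffun measurableT
    (f := fun g x => h2 (translate_vec g^-1%g x))); first last.
  - by move=> g x _; exact: h20.
  - move=> g.
    exact: (measurableT_comp mh2 (measurable_translate_vec g^-1%g)).
  rewrite (eq_bigr (fun=> \int[lebesgue_ffun]_x h2 x))%E; last first.
    by move=> g _; exact: (ge0_integral_translate _ mh2 h20).
  set c := (\int[lebesgue_ffun]_x h2 x)%E.
  have -> : (\sum_(g : gT) c = #|gT|%:R%:E * c)%E.
    by rewrite mule_natl sumr_const.
  have c0 : (0 <= c)%E by apply: integral_ge0 => x _; exact: h20.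
  by rewrite poweRM ?lee_fin// poweR_EFin.
rewrite [root_of _ _]/= mul1e; case: ifP => // _.
set M := (X in (_ <= X)%E); apply/ess_supP.
(* Almost everywhere, the bound [M] holds on the whole (finite) orbit. *)
have : \forall x \ae lebesgue_ffun, forall g, (h1 (translate_vec g x) <= M)%E.
  apply: filter_forall => g; apply: (@ae_translate g [set x | h1 x <= M]%E).
  apply: filterS (ess_sup_ge _ _) => x; apply: le_trans; exact: lee_abs.
apply: filterS => x hM /=.
have M0 : (0 <= M)%E by exact: le_trans (hM 1%g).
rewrite patchE; case: ifPn => [Ox|_]; last by rewrite abse0.
rewrite gee0_abs ?lee_fin; last exact: (lp_norm_ge0 +oo%E).
elim/big_ind : _ => // [y z yM zM|[j g] _]; first by case: (leP y z).
apply: le_trans (hM g^-1%g); rewrite /h1 patchE memE Ox lee_fin fE.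
exact: (@le_bigmax _ _ _ _ (fun j => `|f1 (translate_vec g^-1%g x) j|) j).
Qed.

End translation.

Theorem theorem4p1 (R : realType) (gT : finGroupType) (eps : R) (p : \bar R)
    (C0 N : nat) (eps_ge0 : 0 <= eps) (p_gt0 : (0 < p)%E)
    (C0_gt0 : (0 < C0)%N) (N_gt0 : (0 < N)%N)
    (Omega : set {ffun 'I_C0 * gT -> R})
    (Omega_inv : G_invariant Omega) (Omega_meas : measurable Omega)
    (rho : R -> R) (rho_meas : measurable_fun [set: R] rho)
    (F : {ffun 'I_C0 * gT -> R} -> {ffun 'I_N * gT -> R})
    (F_meas : measurable_fun [set: {ffun 'I_C0 * gT -> R}] F)
    (F_equi : equivariant F)
    (Ns : seq nat) (Ns_gt0 : all (fun n => (0 < n)%N) Ns)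
    (Phi : fnn R N ('I_C0 * gT)%type Ns)
    (Phi_approx :
      (Lp_norm p Omega (fun x => at_one F x - fnn_real rho Phi x)%R
         <= eps%:E)%E) :
  exists Psi : cnn R gT N C0 Ns ((head N Ns * C0)%N :: nseq (size Ns) 1%N),
    (Lp_norm p Omega (fun x => F x - cnn_real rho Psi x)%R
       <= (root_of p #|gT|)%:E * eps%:E)%E /\
    (cnn_weight Psi <= 2 * fnn_weight Phi)%N.
Proof.
have [Psi [PsiE PsiW]] := cnn_of_fnn rho Phi; exists Psi; split=> //.
apply: (@le_trans _ _ ((root_of p #|gT|)%:E * Lp_norm p Omega
    (fun x => at_one F x - fnn_real rho Phi x)%R)%E); last first.
  apply: lee_wpmul2l => //; rewrite lee_fin.
  by case: (p) => [r||]//=; exact: powR_ge0.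
apply: Lp_norm_orbit => //.
  apply: measurable_ffunB; last exact: measurable_fnn_real.
  apply/measurable_ffunP => j.
  under [X in measurable_fun _ X]eq_fun do rewrite ffunE.
  exact: (measurableT_comp (measurable_ffun_coord (j, 1%g)) F_meas).
move=> x j g; rewrite !ffunE PsiE; congr (_ - _).
(* [F x] at [g] is the translate of [F x] by [g^-1] at [1]. *)
have /(congr1 (fun K => K x)) /= -> := F_equi g^-1%g.
by rewrite translate_vecE invgK mulg1.
Qed.
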